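(* Let $R$ be a principal ideal domain, let $n\geq 3$, and let $A\in \mathrm{M}_n(R)$ be non-scalar. Then $A$ is similar to a matrix $B=(b_{ij})\in \mathrm{M}_n(R)$ such that $b_{12}\mid b_{ij}$ for all $i\neq j$, $1\leq i,j\leq n$, and $b_{12}\mid (b_{ii}-b_{jj})$ for all $1\leq i,j\leq n$. Moreover, $B$ may be chosen (still with these properties) with $b_{ij}=0$ for all $i,j$ such that $j\geq i+2$ and $1\leq i\leq n-2$.
   Context: $\mathrm{M}_n(R)$ is the ring of $n\times n$ matrices over $R$. A matrix is scalar if it is of the form $a1_n$ with $a\in R$, where $1_n$ is the identity matrix. A matrix $B\in \mathrm{M}_n(R)$ is similar to $A\in \mathrm{M}_n(R)$ if there exists $g\in \mathrm{GL}_n(R)$ such that $gAg^{-1}=B$. *)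

(* Defs.v *)
From mathcomp Require Import all_boot all_order all_algebra.

Set Implicit Arguments.
Unset Strict Implicit.
Unset Printing Implicit Defensive.

Import GRing.Theory.
Local Open Scope ring_scope.

(* Ideals are Prop-valued subsets, since membership in an ideal need not be
   decidable; unlike MathComp's idealr_closed, the unit ideal is allowed. *)
Definition is_ideal (R : comNzRingType) (I : R -> Prop) : Prop :=
  [/\ I 0,
      forall x y, I x -> I y -> I (x + y)
    & forall a x, I x -> I (a * x)].

Definition is_pid (R : idomainType) : Prop :=
  forall I : R -> Prop, is_ideal I ->
    exists d : R, forall x, I x <-> exists a, x = a * d.

Definition rdvd (R : comNzRingType) (a b : R) : Prop := exists c, b = c * a.

Definition mx_similar (R : comUnitRingType) (n : nat) (A B : 'M[R]_n) : Prop :=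
  exists2 g : 'M[R]_n, g \in unitmx & g *m A *m invmx g = B.

(* Main.v *)
Require Import Defs.
From mathcomp Require Import all_boot all_order all_algebra.
From mathcomp Require Import ring.
From Stdlib Require Import Classical IndefiniteDescription.
Local Open Scope ring_scope.

Set Implicit Arguments.
Unset Strict Implicit.
Unset Printing Implicit Defensive.

Import GRing.Theory.

(** Write A = a + d M with a the corner entry of A and d a generator of the
    ideal spanned by the entries of A - a. The entries of M span the unit
    ideal. If M is similar to a lower Hessenberg matrix B whose entry (0, 1) is
    a unit, then A is similar to a + d B, whose entry (0, 1) is associate to d,
    and d divides the off-diagonal entries and the differences of diagonal
    entries of a + d B. So the theorem reduces to finding B
    ([primitive_unit_corner]).

    Once the first vector v of a basis is chosen, the other ones can be changed
    to make the matrix lower Hessenberg ([hessenberg_conj]). The entry (0, 1) of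
    the result generates the ideal of all v M phi, where phi ranges over the
    linear forms killing v ([similar_hessenberg_row]); every unimodular v may
    serve as first vector.

    Among the lower Hessenberg matrices similar to M, take B such that the ideal
    of d = B 0 1 is maximal, and suppose that d is not a unit. It then has a
    divisor p generating a maximal ideal. Testing maximality on vectors
    v = x e_0 + s e_j with j >= 2 gives congruences on B modulo d
    ([maximal_corner_dvd]). The decisive choice is x = e - k, s = 1, where
    B j 1 = k d: with w = B j 0 + k al and al = B j j - B 0 0, the new corner
    divides both e d and w - e al. For e = 1 this forces d to divide w - al. If
    p did not divide w, then for e = p the new corner would be coprime to p,
    hence a divisor of d, so that d, and with it p, would divide w - p al: a
    contradiction. So p divides w and al.

    Applying this to B and to its conjugates by 1 + E_{j1}, which have the
    same corner, shows that B is scalar modulo p ([scalar_mod_maximal_corner]);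
    this is where an index j >= 2, that is, size at least 3, is used. But then M
    is scalar modulo p, and as M 0 0 = 0 all its entries are multiples of p,
    although they span the unit ideal. *)

(** * Divisibility *)

Lemma rdvd_refl (R : comNzRingType) (a : R) : rdvd a a.
Proof. by exists 1; rewrite mul1r. Qed.

Lemma rdvd_trans (R : comNzRingType) (b a c : R) :
  rdvd a b -> rdvd b c -> rdvd a c.
Proof. by move=> [x ->] [y ->]; exists (y * x); rewrite mulrA. Qed.

Lemma rdvdMl (R : comNzRingType) (a b c : R) : rdvd a b -> rdvd a (c * b).
Proof. by move=> [x ->]; exists (c * x); rewrite mulrA. Qed.

Lemma rdvdD (R : comNzRingType) (a b c : R) :
  rdvd a b -> rdvd a c -> rdvd a (b + c).
Proof. by move=> [x ->] [y ->]; exists (x + y); rewrite mulrDl. Qed.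

Lemma rdvdB (R : comNzRingType) (a b c : R) :
  rdvd a b -> rdvd a c -> rdvd a (b - c).
Proof. by move=> [x ->] [y ->]; exists (x - y); rewrite mulrBl. Qed.

Lemma rdvd_mx (R : comNzRingType) (p : R) m n (M : 'M[R]_(m, n)) :
  (forall i j, rdvd p (M i j)) -> exists Q, M = p *: Q.
Proof.
move=> pM.
have [q Mq] := fin_all_exists (fun ij : 'I_m * 'I_n => pM ij.1 ij.2).
exists (\matrix_(i, j) q (i, j)); apply/matrixP=> i j.
by rewrite !mxE (Mq (i, j)) mulrC.
Qed.

(** * Similarity and lower Hessenberg form *)

Definition hessenberg (R : nzRingType) n (A : 'M[R]_n) :=
  forall i j : 'I_n, (i + 2 <= j)%N -> A i j = 0.

Lemma delta_mul_block (R : nzRingType) m (k : 'M[R]_m) :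
  (delta_mx 0 0 : 'rV[R]_m.+1) *m (block_mx 1%:M 0 0 k : 'M_(1 + m)) =
  delta_mx 0 0.
Proof.
rewrite -rowE; apply/rowP => j; rewrite [LHS]mxE [RHS]mxE.
have -> : 0 = lshift m 0 :> 'I_(1 + m) by apply: val_inj.
case: (@split_ordP 1 m j) => t ->.
  by rewrite (@block_mxEul _ 1 m 1 m) mxE !ord1.
by rewrite (@block_mxEur _ 1 m 1 m) mxE.
Qed.

Lemma similar_mul (R : comUnitRingType) n (A g g' : 'M[R]_n) :
  g *m g' = 1%:M -> mx_similar A (g *m A *m g').
Proof.
move=> gg'; have [gU _] := mulmx1_unit gg'.
by exists g => //; rewrite -[g' in RHS](mulKmx gU) gg' mulmx1.
Qed.

Lemma similar_trans (R : comUnitRingType) n (A B C : 'M[R]_n) :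
  mx_similar A B -> mx_similar B C -> mx_similar A C.
Proof.
move=> [g gU <-] [h hU <-]; rewrite !mulmxA -(mulmxA _ (invmx g)).
by apply: similar_mul; rewrite mulmxA mulmxK ?mulmxV.
Qed.

(** * Arithmetic of a principal ideal domain *)

Section PrincipalIdealDomain.

Variables (R : idomainType) (hR : is_pid R).

(** The ascending chain condition: a failing property would produce, by
    dependent choice, a strictly ascending chain of principal ideals, whose
    union is generated by an element of one of its members. *)
Lemma pid_maximal (P : R -> Prop) : (exists x, P x) ->
  exists2 x, P x & forall y, P y -> rdvd y x -> rdvd x y.
Proof.
move=> [x0 Px0]; apply: NNPP => nomax.
have step (x : {x | P x}) : exists y : {x | P x},
    rdvd (sval y) (sval x) /\ ~ rdvd (sval x) (sval y).
  case: x => x Px /=; apply: NNPP => nostep; apply: nomax.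
  exists x => // y Py yx; apply: NNPP => nxy.
  by apply: nostep; exists (exist _ y Py).
have [f fP] := functional_choice _ step.
pose c n := sval (iter n f (exist _ x0 Px0)).
have cS n : rdvd (c n.+1) (c n) /\ ~ rdvd (c n) (c n.+1) by exact: fP.
have cD n k : rdvd (c (n + k)%N) (c n).
  elim: k => [|k IHk]; first by rewrite addn0; apply: rdvd_refl.
  by rewrite addnS; apply: rdvd_trans IHk; case: (cS (n + k)%N).
have [d dP] : exists d, forall x,
    (exists n, rdvd (c n) x) <-> exists a, x = a * d.
  apply: hR; split.
  - by exists 0%N, 0; rewrite mul0r.
  - move=> x y [n nx] [k ky]; exists (n + k)%N; apply: rdvdD.
      exact: rdvd_trans nx.
    by rewrite addnC; apply: rdvd_trans ky.
  - by move=> a x [n nx]; exists n; apply: rdvdMl.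
have [n nd] : exists n, rdvd (c n) d by apply/dP; exists 1; rewrite mul1r.
have [a ca] : exists a, c n.+1 = a * d.
  by apply/dP; exists n.+1; apply: rdvd_refl.
by case: (cS n) => _; apply; rewrite ca; apply: rdvdMl.
Qed.

(** The cofactors a' and b' are coprime even when a = b = 0, which spares all
    later uses a case distinction. *)
Lemma pid_bezout (a b : R) : exists g x y a' b',
  [/\ a = a' * g, b = b' * g & x * a' + y * b' = 1].
Proof.
have [g gP] : exists g, forall z,
    (exists x y, z = x * a + y * b) <-> exists c, z = c * g.
  apply: hR; split.
  - by exists 0, 0; ring.
  - by move=> _ _ [x [y ->]] [x' [y' ->]]; exists (x + x'), (y + y'); ring.
  - by move=> c _ [x [y ->]]; exists (c * x), (c * y); ring.
have [a' aE] : exists c, a = c * g by apply/gP; exists 1, 0; ring.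
have [b' bE] : exists c, b = c * g by apply/gP; exists 0, 1; ring.
have [x [y gE]] : exists x y, g = x * a + y * b.
  by apply/gP; exists 1; rewrite mul1r.
have [g0|g0] := eqVneq g 0.
  by exists 0, 1, 0, 1, 0; split; rewrite ?aE ?bE ?g0; ring.
exists g, x, y, a', b'; split=> //; apply: (mulIf g0).
by rewrite mul1r {2}gE aE bE; ring.
Qed.

(** Such a p generates a maximal ideal. Expressing this by a Bezout identity,
    rather than by irreducibility, also covers d = 0 in a field, where
    p = 0. *)
Lemma pid_coprime_divisor (d : R) : ~~ (d \is a GRing.unit) ->
  exists p, [/\ ~~ (p \is a GRing.unit), rdvd p d &
    forall x, ~ rdvd p x -> exists a b, a * p + b * x = 1].
Proof.
move=> dN.
have [|p [pN pd] pmax] := @pid_maximal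
    (fun p => ~~ (p \is a GRing.unit) /\ rdvd p d).
  by exists d; split=> //; apply: rdvd_refl.
exists p; split=> // x npx.
have [g [a [b [p' [x' [pE xE ab1]]]]]] := pid_bezout p x.
have gp : rdvd g p by exists p'.
have [gU|gN] := boolP (g \is a GRing.unit).
  exists (g^-1 * a), (g^-1 * b).
  rewrite -(mulVr gU) -[in RHS](mulr1 g^-1) -ab1 {1}pE {1}xE; ring.
case: npx; apply: (@rdvd_trans _ g); last by exists x'.
by apply: pmax => //; split=> //; apply: rdvd_trans pd.
Qed.

(** Induction on the length: reduce the tail to (z, 0, ..., 0), then merge z
    into the first entry by an invertible 2 x 2 matrix built from a Bezout
    identity. *)
Lemma pid_row_reduce m (r : 'rV[R]_m.+1) :
  exists2 g : 'M_m.+1, g \in unitmx & exists z, r *m g = z *: delta_mx 0 0.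
Proof.
elim: m r => [|m IHm] r.
  exists 1%:M; first exact: unitmx1.
  exists (r 0 0); rewrite mulmx1; apply/matrixP=> i j.
  by rewrite !mxE !ord1 mulr1.
pose a : 'M_1 := lsubmx (r : 'rV_(1 + m.+1)).
pose s : 'rV_m.+1 := rsubmx (r : 'rV_(1 + m.+1)).
have rE : r = row_mx a s by rewrite hsubmxK.
have [h hU [z sh]] := IHm s.
have [g [x [y [a' [b' [aE zE xy1]]]]]] := pid_bezout (a 0 0) z.
pose e : 'rV[R]_m.+1 := delta_mx 0 0.
pose f : 'cV[R]_m.+1 := delta_mx 0 0.
pose E : 'M[R]_m.+1 := delta_mx 0 0.
have ef : e *m f = 1%:M.
  by rewrite mul_delta_mx; apply/matrixP=> i j; rewrite !mxE !ord1.
have fe : f *m e = E by rewrite mul_delta_mx.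
have eE : e *m E = e by rewrite mul_delta_mx.
have Ef : E *m f = f by rewrite mul_delta_mx.
have EE : E *m E = E by rewrite mul_delta_mx.
(* The 2 x 2 matrix with rows (x, - b') and (y, a'), of determinant 1,
   extended by the identity. *)
pose G : 'M[R]_(1 + m.+1) :=
  block_mx x%:M (- b' *: e) (y *: f) (1%:M + (a' - 1) *: E).
pose G' : 'M[R]_(1 + m.+1) :=
  block_mx a'%:M (b' *: e) (- y *: f) (1%:M + (x - 1) *: E).
have GG' : G *m G' = 1%:M.
  rewrite mulmx_block scalar_mx_block !mul_scalar_mx !mul_mx_scalar.
  rewrite !(mulmxDl, mulmxDr, mulmx1, mul1mx).
  rewrite -!scalemxAl -!scalemxAr ef fe eE Ef EE.
  congr block_mx.
  - rewrite -[a'%:M]scalemx1 !scalerA -scalerDl -[RHS]scale1r.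
    by congr (_ *: _); rewrite -xy1; ring.
  - by rewrite !scalerA -!scalerDl -[RHS](scale0r e); congr (_ *: _); ring.
  - by rewrite !scalerA -!scalerDl -[RHS](scale0r f); congr (_ *: _); ring.
  - rewrite !scalerA addrCA -!addrA -!scalerDl -[RHS]addr0 -(scale0r E).
    congr (_ + _ *: _).
    by transitivity ((x * a' + y * b') - 1); [ring | rewrite xy1 subrr].
pose H : 'M[R]_(1 + m.+1) := block_mx 1%:M 0 0 h.
have HU : H \in unitmx by rewrite unitmxE det_ublock det1 mul1r -unitmxE.
exists (H *m G); first by rewrite unitmx_mul HU; case: (mulmx1_unit GG').
exists g; rewrite rE mulmxA.
change (row_mx a s *m H *m G = (g *: delta_mx 0 0 : 'rV[R]_(1 + m.+1))).
rewrite mul_row_block !(mulmx0, mulmx1) addr0 add0r sh.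
rewrite mul_row_block mul_mx_scalar mulmxDr mulmx1 -!scalemxAl -!scalemxAr.
rewrite -/e ef eE (mx11_scalar a) -![(a 0 0)%:M]scalemx1 -!scalemxAl mul1mx.
rewrite !scalerA -!scalerDl aE zE.
have -> : x * (a' * g) + b' * g * y = g by rewrite -[RHS]mul1r -xy1; ring.
have -> : - b' * (a' * g) + (b' * g + b' * g * (a' - 1)) = 0 by ring.
rewrite scale0r; apply/matrixP=> i k; rewrite ord1.
by case: (split_ordP k) => t ->; rewrite ?row_mxEl ?row_mxEr !mxE ?ord1 ?mulr0.
Qed.

(** * Choosing the first basis vector *)

(** Keeping the first basis vector, change the others so that the tail of the
    first row becomes (z, 0, ..., 0); the induction then acts on the lower right
    block with a conjugation that fixes its first basis vector, hence leaves
    that tail alone. *)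
Lemma hessenberg_conj m (A : 'M[R]_(1 + m)) :
  exists k k' : 'M_m, k *m k' = 1%:M /\
    hessenberg (block_mx 1%:M 0 0 k *m A *m block_mx 1%:M 0 0 k').
Proof.
elim: m A => [|m IHm] A.
  by exists 1%:M, 1%:M; rewrite mulmx1; split=> // i j; rewrite !ord1.
have [g gU [z rz]] := pid_row_reduce (ursubmx A).
have [k1 [k1' [kk1 H1]]] := IHm (invmx g *m drsubmx A *m g).
pose K : 'M[R]_(1 + m) := block_mx 1%:M 0 0 k1.
pose K' : 'M[R]_(1 + m) := block_mx 1%:M 0 0 k1'.
have KK' : K *m K' = 1%:M.
  rewrite mulmx_block !(mulmx0, mul0mx, mulmx1, addr0, add0r) kk1.
  by rewrite -scalar_mx_block.
exists (K *m invmx g), (g *m K'); split.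
  by rewrite mulmxA mulmxKV.
rewrite -(submxK A) !mulmx_block.
rewrite !(mulmx0, mul0mx, mul1mx, mulmx1, addr0, add0r).
move=> i j; case: (split_ordP i) => i' ->; case: (split_ordP j) => j' ->.
- by rewrite !ord1.
- rewrite block_mxEur mulmxA rz => ij.
  rewrite -scalemxAl delta_mul_block !mxE.
  by case: (j' =P 0) ij => [->|_ _]; rewrite ?ord1 ?andbF ?mulr0.
- by rewrite !ord1 addnC.
- rewrite block_mxEdr => ij; rewrite !mulmxA; rewrite !mulmxA in H1; apply: H1.
  by move: ij; rewrite /= -addnA leq_add2l.
Qed.

(** The new basis has v as first vector up to a unit, and the first row of B
    is (b_0, b_1, 0, ..., 0). A column phi killed by v has first coordinate 0
    in the dual basis, so only b_1 contributes to v A phi. *)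
Lemma similar_hessenberg_row m (A : 'M[R]_m.+2)
    (v : 'rV_m.+2) (psi : 'cV_m.+2) :
  v *m psi = 1%:M ->
  exists B, [/\ mx_similar A B, hessenberg B &
    forall phi : 'cV_m.+2, v *m phi = 0 ->
      rdvd (B 0 (lift 0 0)) ((v *m A *m phi) 0 0)].
Proof.
move=> vpsi; have [g gU [z vz]] := pid_row_reduce v.
have zU : z \is a GRing.unit.
  apply/unitrP; exists ((invmx g *m psi) 0 0).
  have: (v *m g *m (invmx g *m psi)) 0 0 = 1.
    by rewrite mulmxA mulmxK // vpsi mxE.
  by rewrite vz -scalemxAl -rowE !mxE => zE; rewrite mulrC zE.
have [k [k' [kk' H]]] := @hessenberg_conj m.+1 (invmx g *m A *m g).
set K : 'M[R]_(1 + m.+1) := block_mx 1%:M 0 0 k in H.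
set K' : 'M[R]_(1 + m.+1) := block_mx 1%:M 0 0 k' in H.
have KK' : K *m K' = 1%:M.
  rewrite mulmx_block !(mulmx0, mul0mx, mulmx1, addr0, add0r) kk'.
  by rewrite -scalar_mx_block.
have K'K : K' *m K = 1%:M by apply: mulmx1C.
set B := _ *m _ *m _ in H.
have BE : B = (K *m invmx g) *m A *m (g *m K') by rewrite /B !mulmxA.
clearbody B.
have GG' : (K *m invmx g) *m (g *m K') = 1%:M by rewrite mulmxA mulmxKV.
exists B; split=> [||phi vphi] //; first by rewrite BE; apply: similar_mul.
have vE : v = z *: row 0 (K *m invmx g).
  by rewrite rowE mulmxA delta_mul_block scalemxAl -vz mulmxK.
set y := K *m invmx g *m phi.
have y0 : y 0 0 = 0.
  apply: (mulrI zU); transitivity ((v *m phi) 0 0).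
    by rewrite vE -scalemxAl -row_mul !mxE.
  by rewrite vphi mxE mulr0.
have -> : v *m A *m phi = z *: row 0 (B *m y).
  rewrite vE -!scalemxAl -!row_mul BE /y -!mulmxA; congr (_ *: row _ (_ *m _)).
  congr (_ *m (_ *m _)).
  by rewrite (mulmxA K' K) K'K mul1mx mulmxA mulmxV // mul1mx.
rewrite !mxE !big_ord_recl big1 => [|j _]; last first.
  by rewrite H ?mul0r.
by rewrite y0 mulr0 add0r addr0; exists (z * y (lift 0 0) 0); ring.
Qed.

(** The case v = x e_i + s e_j of the previous lemma. The forms used are the
    coordinates e_k^* for k distinct from i and j, and s e_i^* - x e_j^*. *)
Lemma similar_hessenberg_pair m (A : 'M[R]_m.+2)
    (i j : 'I_m.+2) (x s x' s' : R) :
  i != j -> x' * x + s' * s = 1 ->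
  exists B, [/\ mx_similar A B, hessenberg B,
    forall k, k != i -> k != j ->
      rdvd (B 0 (lift 0 0)) (x * A i k + s * A j k) &
    rdvd (B 0 (lift 0 0))
      (s * (x * A i i + s * A j i) - x * (x * A i j + s * A j j))].
Proof.
move=> ij xs1; have ji : j != i by rewrite eq_sym.
pose v : 'rV_m.+2 := x *: delta_mx 0 i + s *: delta_mx 0 j.
have vM p (M : 'M_(m.+2, p)) k : (v *m M) 0 k = x * M i k + s * M j k.
  by rewrite mulmxDl -!scalemxAl -!rowE !mxE.
pose e k : 'cV[R]_m.+2 := delta_mx k 0.
have ve k : v *m e k = (x * (i == k)%:R + s * (j == k)%:R)%:M.
  by apply/matrixP=> a b; rewrite !ord1 vM !mxE !andbT.
have [|B [AB HB Bv]] := @similar_hessenberg_row _ A v (x' *: e i + s' *: e j).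
  rewrite mulmxDr -!scalemxAr !ve !eqxx (negPf ij) (negPf ji).
  by rewrite !mulr0 addr0 add0r !mulr1 !scale_scalar_mx -raddfD /= xs1.
have vAe k : (v *m A *m e k) 0 0 = x * A i k + s * A j k.
  by rewrite -colE mxE vM.
exists B; split=> // [k ki kj|].
  rewrite -vAe; apply: Bv; rewrite ve ![_ == k]eq_sym (negPf ki) (negPf kj).
  by rewrite !mulr0 addr0 raddf0.
have sB (M N : 'M[R]_1) : (s *: M - x *: N) 0 0 = s * M 0 0 - x * N 0 0.
  by rewrite !mxE.
have := Bv (s *: e i - x *: e j); rewrite !mulmxBr -!scalemxAr !ve.
rewrite !eqxx (negPf ij) (negPf ji) !mulr0 addr0 add0r !mulr1 !scale_scalar_mx.
by rewrite -raddfB mulrC subrr raddf0 => /(_ erefl); rewrite sB !vAe.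
Qed.

(** * Consequences of a maximal corner *)

(** The maximality of d = A 0 1 is tested on combinations of e_0 and e_j. For
    the first conclusion, v = x e_0 + s e_j with x d + s (A j 1) the gcd of d
    and A j 1. The other two compare v = (e - k) e_0 + e_j, where
    A j 1 = k d, for e = 1 and e = p. *)
Lemma maximal_corner_dvd m (A : 'M[R]_m.+2) (p : R) :
  let d := A 0 (lift 0 0) in
  (forall B, mx_similar A B -> hessenberg B ->
    rdvd (B 0 (lift 0 0)) d -> rdvd d (B 0 (lift 0 0))) ->
  rdvd p d ->
  (forall x, ~ rdvd p x -> exists a b, a * p + b * x = 1) ->
  forall j : 'I_m.+2, (2 <= j)%N -> A 0 j = 0 ->
  [/\ rdvd d (A j (lift 0 0)), rdvd p (A j 0) & rdvd p (A j j - A 0 0)].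
Proof.
move=> d dmax pd pP j j2 A0j.
have j0 : 0 != j by apply: contraTneq j2 => <-.
have j1 : lift 0 0 != j by apply: contraTneq j2 => <-.
have d10 : lift 0 0 != 0 :> 'I_m.+2 by [].
have dAj1 : rdvd d (A j (lift 0 0)).
  have [g [x [s [d' [a' [dE aE xs1]]]]]] := pid_bezout d (A j (lift 0 0)).
  have xs1' : d' * x + a' * s = 1 by rewrite -xs1; ring.
  have [B [AB HB B1 _]] := similar_hessenberg_pair A j0 xs1'.
  have Bg : rdvd (B 0 (lift 0 0)) g.
    have := B1 _ d10 j1; rewrite -/d; congr rdvd.
    by rewrite [in LHS]dE [in LHS]aE -[RHS]mul1r -xs1; ring.
  have gd : rdvd g d by exists d'.
  apply: (@rdvd_trans _ g); last by exists a'.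
  exact: (rdvd_trans (dmax _ AB HB (rdvd_trans Bg gd))).
have [k kE] := dAj1.
set al := A j j - A 0 0.
pose w := A j 0 + k * al.
have pair e : exists B, [/\ mx_similar A B, hessenberg B,
    rdvd (B 0 (lift 0 0)) (e * d) & rdvd (B 0 (lift 0 0)) (w - e * al)].
  (* With s = 1 and x = e - k, the entry x d + s (A j 1) is e d. *)
  have xs1 : 0 * (e - k) + 1 * 1 = 1 :> R by ring.
  have [B [AB HB B1 B2]] := similar_hessenberg_pair A j0 xs1.
  exists B; split=> //.
    by have := B1 _ d10 j1; rewrite kE -/d; congr rdvd; ring.
  by move: B2; rewrite A0j /w /al; congr rdvd; ring.
(* e = 1: the new corner divides d, so d divides it by maximality. *)
have pw_al : rdvd p (w - al).
  have [B [AB HB]] := pair 1; rewrite !mul1r => Bd Bw.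
  exact: (rdvd_trans pd (rdvd_trans (dmax _ AB HB Bd) Bw)).
(* e = p: if p does not divide w, the new corner divides p d and is coprime
   to p, since it divides w - p al. *)
have pw : rdvd p w.
  apply: NNPP => npw; have [a [b ab1]] := pP _ npw.
  have [B [AB HB Bpd Bw]] := pair p.
  have Bd : rdvd (B 0 (lift 0 0)) d.
    have -> : d = a * (p * d) + b * (d * (w - p * al)) + b * al * (p * d).
      by rewrite -[LHS]mul1r -ab1; ring.
    apply: rdvdD; last exact: rdvdMl.
    by apply: rdvdD; [exact: rdvdMl | do 2!apply: rdvdMl].
  apply: npw; have -> : w = (w - p * al) + al * p by ring.
  apply: rdvdD; last by exists al.
  exact: (rdvd_trans pd (rdvd_trans (dmax _ AB HB Bd) Bw)).
have pal : rdvd p al.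
  have -> : al = w - (w - al) by ring.
  exact: rdvdB.
split=> //; have -> : A j 0 = w - k * al by rewrite /w; ring.
by apply: rdvdB => //; apply: rdvdMl.
Qed.

(** For the rows j >= 2 the previous lemma controls columns 0 and 1 and the
    diagonal; the rest comes from applying it to conjugates of A.
    Conjugation by 1 + E_{j1} adds row 1 to row j and subtracts column j from
    column 1. It leaves the first row unchanged, carries the entries of row 1
    into row j, and carries those of column j into column 1. *)
Lemma scalar_mod_maximal_corner m (A : 'M[R]_m.+3) (p : R) :
  let d := A 0 (lift 0 0) in
  hessenberg A ->
  (forall B, mx_similar A B -> hessenberg B ->
    rdvd (B 0 (lift 0 0)) d -> rdvd d (B 0 (lift 0 0))) ->
  rdvd p d ->
  (forall x, ~ rdvd p x -> exists a b, a * p + b * x = 1) ->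
  exists Q, A = (A 0 0)%:M + p *: Q.
Proof.
move=> d HA dmax pd pP; set i1 : 'I_m.+3 := lift 0 0.
have A0 (j : 'I_m.+3) : (2 <= j)%N -> A 0 j = 0 by move=> j2; apply: HA.
have p0 : rdvd p 0 by exists 0; rewrite mul0r.
have KA (j : 'I_m.+3) : (2 <= j)%N ->
    [/\ rdvd p (A j i1), rdvd p (A j 0) & rdvd p (A j j - A 0 0)].
  move=> j2; have [dj ? ?] := maximal_corner_dvd dmax pd pP j2 (A0 j j2).
  by split=> //; apply: (@rdvd_trans _ d).
have KC (j : 'I_m.+3) : (2 <= j)%N ->
    [/\ rdvd p (A i1 0), rdvd p (A i1 j), rdvd p (A i1 i1 - A 0 0) &
        forall k : 'I_m.+3, (2 <= k)%N -> k != j -> rdvd p (A k j)].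
  move=> j2; have [pj1 pj0 pjj] := KA j j2.
  have j0 : j != 0 by apply: contraTneq j2 => ->.
  have j1 : i1 != j by apply: contraTneq j2 => <-.
  pose E : 'M[R]_m.+3 := delta_mx j i1.
  have EE : E *m E = 0 by rewrite mul_delta_mx_0.
  pose C := (1%:M + E) *m A *m (1%:M - E).
  have AC : mx_similar A C.
    apply: similar_mul; rewrite mulmxBr mulmx1 mulmxDl mul1mx EE addr0.
    by rewrite addrK.
  have CE a b : C a b = A a b + (a == j)%:R * A i1 b
      - (b == i1)%:R * (A a j + (a == j)%:R * A i1 j).
    have EM c e (M : 'M[R]_m.+3) : (E *m M) c e = (c == j)%:R * M i1 e.
      rewrite mxE (bigD1 i1) //= big1 ?addr0 => [|k /negPf ki].
        by rewrite !mxE eqxx andbT.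
      by rewrite !mxE ki andbF mul0r.
    have ME c e (M : 'M[R]_m.+3) : (M *m E) c e = (e == i1)%:R * M c j.
      rewrite mxE (bigD1 j) //= big1 ?addr0 => [|k /negPf kj].
        by rewrite !mxE eqxx mulrC.
      by rewrite !mxE kj mulr0.
    have sumE (M N : 'M[R]_m.+3) c e : (M + N) c e = M c e + N c e.
      by rewrite mxE.
    rewrite /C mulmxBr mulmx1 sumE [X in _ + X = _]mxE ME mulmxDl mul1mx.
    by rewrite !sumE !EM.
  have C01 : C 0 (lift 0 0) = d.
    by rewrite CE [0 == j]eq_sym (negPf j0) eqxx (A0 j j2) -/i1 -/d /=; ring.
  have CA0 (k : 'I_m.+3) : (2 <= k)%N -> C 0 k = 0.
    move=> k2; rewrite CE [0 == j]eq_sym (negPf j0) (A0 j j2) (A0 k k2).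
    have /negPf-> : k != i1 by apply: contraTneq k2 => ->.
    by rewrite /=; ring.
  have Cmax B : mx_similar C B -> hessenberg B ->
      rdvd (B 0 (lift 0 0)) (C 0 (lift 0 0)) ->
      rdvd (C 0 (lift 0 0)) (B 0 (lift 0 0)).
    by rewrite C01 => CB; apply: dmax; apply: similar_trans CB.
  have pC : rdvd p (C 0 (lift 0 0)) by rewrite C01.
  have KCj (k : 'I_m.+3) (k2 : (2 <= k)%N) :=
    maximal_corner_dvd Cmax pC pP k2 (CA0 k k2).
  have k1F (k : 'I_m.+3) : (2 <= k)%N -> (k == i1) = false.
    by move=> k2; apply/negbTE; apply: contraTneq k2 => ->.
  have [pCj1 pCj0 pCjj] := KCj j j2; rewrite C01 in pCj1.
  have i10 : (0 == i1) = false by [].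
  have j0F : (0 == j) = false by rewrite eq_sym (negPf j0).
  have pA10 : rdvd p (A i1 0).
    have -> : A i1 0 = C j 0 - A j 0 by rewrite CE eqxx i10 /=; ring.
    exact: rdvdB.
  have pA1j : rdvd p (A i1 j).
    have -> : A i1 j = (C j j - C 0 0) - (A j j - A 0 0).
      by rewrite !CE eqxx i10 j0F k1F //=; ring.
    exact: rdvdB.
  split=> // [|k k2 kj].
    have -> : A i1 i1 - A 0 0 =
        (C j i1 - A j i1) + ((A j j - A 0 0) + A i1 j).
      by rewrite CE !eqxx /=; ring.
    apply: rdvdD; last exact: rdvdD.
    by apply: rdvdB => //; exact: rdvd_trans pCj1.
  have [pAk1 _ _] := KA k k2; have [dCk1 _ _] := KCj k k2; rewrite C01 in dCk1.
  have -> : A k j = A k i1 - C k i1.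
    by rewrite CE eqxx (negPf kj) /=; ring.
  by apply: rdvdB => //; exact: rdvd_trans dCk1.
have pA i j : rdvd p ((A - (A 0 0)%:M) i j).
  have split3 (k : 'I_m.+3) : [\/ k = 0, k = i1 | (2 <= k)%N].
    case: k => -[|[|k]] lk; last by constructor 3.
      by constructor 1; apply: val_inj.
    by constructor 2; apply: val_inj.
  have [p10 _ p11 _] := KC ord_max isT.
  have -> : (A - (A 0 0)%:M) i j = A i j - A 0 0 *+ (i == j) by rewrite !mxE.
  case: (split3 i) => [->|->|i2]; case: (split3 j) => [->|->|j2].
  - by rewrite eqxx subrr.
  - by rewrite subr0.
  - by rewrite (A0 j j2) sub0r; case: eqP j2 => [<-|] //; rewrite oppr0.
  - by rewrite subr0.
  - by rewrite eqxx.
  - case: eqP j2 => [<-|_ j2] //; rewrite subr0.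
    by case: (KC j j2).
  - case: eqP i2 => [->|_ i2] //; rewrite subr0.
    by case: (KA i i2).
  - case: eqP i2 => [->|_ i2] //; rewrite subr0.
    by case: (KA i i2).
  - have [<-|ij] := eqVneq i j; first by case: (KA i i2).
    by rewrite subr0; case: (KC j j2) => _ _ _; apply.
have [Q QE] := rdvd_mx pA.
by exists Q; rewrite -QE addrC subrK.
Qed.

(** * Reduction to a primitive matrix *)

(** The trace condition says that the entries of M generate the unit ideal: the
    linear combinations of the entries of M are the traces of N M. *)
Lemma primitive_unit_corner m (M N : 'M[R]_m.+3) :
  M 0 0 = 0 -> \tr (N *m M) = 1 ->
  exists B, [/\ mx_similar M B, hessenberg B & B 0 (lift 0 0) \is a GRing.unit].
Proof.
move=> M00 trNM.
have [|d [A [MA HA Ad]] dmax] := @pid_maximal (fun d => exists B : 'M[R]_m.+3,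
    [/\ mx_similar M B, hessenberg B & B 0 (lift 0 0) = d]).
  have [|B [MB HB _]] :=
    @similar_hessenberg_row _ M (delta_mx 0 0) (delta_mx 0 0).
    by rewrite mul_delta_mx; apply/matrixP=> i j; rewrite !mxE !ord1.
  by exists (B 0 (lift 0 0)), B.
exists A; split=> //; apply: contraT; rewrite Ad => dN.
have [p [pN pd pP]] := pid_coprime_divisor dN.
have [Q AQ] : exists Q, A = (A 0 0)%:M + p *: Q.
  apply: scalar_mod_maximal_corner => //; rewrite Ad // => B AB HB.
  by apply: dmax; exists B; split=> //; apply: similar_trans AB.
case: MA => g gU gA; set b := A 0 0 in AQ.
pose Q' := invmx g *m Q *m g.
have MQ : M = b%:M + p *: Q'.
  have -> : M = invmx g *m A *m g.
    by rewrite -gA !mulmxA mulVmx // mul1mx mulmxKV.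
  rewrite AQ mulmxDr mulmxDl -scalemxAr -scalemxAl; congr (_ + _).
  by rewrite mul_mx_scalar -scalemxAl mulVmx // scalemx1.
have bE : b = - (p * Q' 0 0).
  by apply/eqP; rewrite -addr_eq0 -[X in _ == X]M00 MQ !mxE eqxx.
case/negP: pN; apply/unitrP; exists (\tr (N *m (Q' - (Q' 0 0)%:M))).
rewrite mulrC; suff -> : p * \tr (N *m (Q' - (Q' 0 0)%:M)) = 1 by [].
rewrite -mxtraceZ scalemxAr -[RHS]trNM; congr (\tr (_ *m _)).
by rewrite MQ bE scalerBr scale_scalar_mx raddfN addrC.
Qed.

(** Here d generates the ideal spanned by the entries of A - a, with
    a = A 0 0. It is nonzero because A is not scalar, so it can be cancelled
    from d = tr (N (A - a)) = d tr (N M). *)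
Lemma nonscalar_primitive m (A : 'M[R]_m.+1) : ~~ is_scalar_mx A ->
  exists a d M N, [/\ A = a%:M + d *: M, M 0 0 = 0 & \tr (N *m M) = 1].
Proof.
move=> An; set a := A 0 0; set C := A - a%:M.
have [d dP] : exists d, forall x,
    (exists N, x = \tr (N *m C)) <-> exists c, x = c * d.
  apply: hR; split.
  - by exists 0; rewrite mul0mx mxtrace0.
  - by move=> _ _ [N ->] [N' ->]; exists (N + N'); rewrite mulmxDl mxtraceD.
  - by move=> c _ [N ->]; exists (c *: N); rewrite -scalemxAl mxtraceZ.
have [M CM] : exists M, C = d *: M.
  apply: rdvd_mx => i j; apply/dP; exists (delta_mx j i).
  rewrite mxtrace_mulC /mxtrace (bigD1 i) //= big1 => [|k /negPf ki].
    rewrite [X in _ = X + _]mxE (bigD1 j) //= big1 => [|l /negPf lj].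
      by rewrite !mxE !eqxx /= mulr1 !addr0.
    by rewrite !mxE lj mulr0.
  by rewrite mxE big1 // => l _; rewrite !mxE ki andbF mulr0.
have dn0 : d != 0.
  apply: contra An => /eqP d0; apply/is_scalar_mxP; exists a.
  by apply/eqP; rewrite -subr_eq0 -/C CM d0 scale0r.
have [N dE] : exists N, d = \tr (N *m C) by apply/dP; exists 1; rewrite mul1r.
exists a, d, M, N; split.
- by rewrite -CM addrC subrK.
- apply: (mulfI dn0); rewrite mulr0; transitivity (C 0 0).
    by rewrite CM mxE.
  by rewrite !mxE eqxx subrr.
- by apply: (mulfI dn0); rewrite mulr1 -mxtraceZ scalemxAr -CM.
Qed.

End PrincipalIdealDomain.

(** * The theorem *)

Theorem theorem5p6 (R : idomainType) (hR : is_pid R) (n : nat) (hn : (3 <= n)%N)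
    (A : 'M[R]_n) (hA : ~~ is_scalar_mx A) :
  exists B : 'M[R]_n,
    let b12 := B (Ordinal (ltnW (ltnW hn))) (Ordinal (ltnW hn)) in
    [/\ mx_similar A B,
        forall i j : 'I_n, i != j -> rdvd b12 (B i j),
        forall i j : 'I_n, rdvd b12 (B i i - B j j)
      & forall i j : 'I_n, (i + 2 <= j)%N -> B i j = 0].
Proof.
case: n hn A hA => [|[|[|m]]] // hn A hA.
have [a [d [M [N [AE M00 trNM]]]]] := nonscalar_primitive hR hA.
have [B [[g gU gM] HB Bu]] := primitive_unit_corner hR M00 trNM.
have -> : Ordinal (ltnW (ltnW hn)) = 0 by apply: val_inj.
have -> : Ordinal (ltnW hn) = lift 0 0 by apply: val_inj.
exists (a%:M + d *: B) => b12.
have b12E : b12 = d * B 0 (lift 0 0) by rewrite /b12 !mxE add0r.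
have b12d x : rdvd b12 (d * x).
  exists (x / B 0 (lift 0 0)).
  by rewrite b12E mulrCA divrK.
split.
- exists g => //; rewrite AE mulmxDr mulmxDl -scalemxAr -scalemxAl gM.
  by rewrite mul_mx_scalar -scalemxAl mulmxV // scalemx1.
- by move=> i j /negPf ij; rewrite !mxE ij add0r.
- move=> i j; have -> : (a%:M + d *: B) i i - (a%:M + d *: B) j j =
      d * (B i i - B j j) by rewrite !mxE !eqxx; ring.
  exact: b12d.
- move=> i j ij; rewrite !mxE HB // mulr0 addr0.
  by case: eqP ij => // ->; rewrite addn2 ltnNge leqnSn.
Qed.
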